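(* Let $R$ be an Abelian exchange ring and let $G$ be a locally finite group. Then the following conditions are equivalent: (i) The identity element of the group ring $RG$ is a sum of two units of $RG$. (ii) The identity element of $R$ is a sum of two units of $R$. (iii) $R$ does not have any factor ring isomorphic to $\mathbb{Z}_2$ (the field with two elements). (iv) Every element of $RG$ is a sum of two units of $RG$.
   Context: All rings are associative with identity, not necessarily commutative. For a ring $R$ and a group $G$, $RG$ denotes the group ring of $G$ over $R$. A group is locally finite if each of its finitely generated subgroups is finite. A ring is Abelian if all its idempotents are central. A ring $R$ is an exchange ring if for every $a\in R$ there is an idempotent $e\in aR$ with $1-e\in (1-a)R$ (equivalently, the module $R_R$ has the finite exchange property). A factor ring of $R$ is a ring $R/I$ with $I$ a two-sided ideal of $R$. *)

(* Defs.v *)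
From HB Require Import structures.
From mathcomp Require Import all_boot all_order all_algebra finmap.
From mathcomp Require Import classical_sets cardinality.
From mathcomp.multinomials Require Import xfinmap monalg.

Set Implicit Arguments.
Unset Strict Implicit.
Unset Printing Implicit Defensive.

Import GRing.Theory.

Local Open Scope ring_scope.
Local Open Scope quotient_scope.

(* Rings are [pzRingType]s, so the zero ring is allowed. The [GRing.unit]
   predicate only exists for nontrivial rings, hence [is_unit]. *)

Section RingNotions.
Variable R : pzRingType.
Implicit Types a e u x : R.

Definition is_unit u := exists v : R, u * v = 1 /\ v * u = 1.

Definition sum_of_two_units x :=
  exists u v : R, [/\ is_unit u, is_unit v & x = u + v].

Definition is_idempotent e := e * e = e.

Definition abelian_ring :=
  forall e, is_idempotent e -> forall x, GRing.comm e x.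

Definition in_right_principal_ideal a x := exists r : R, x = a * r.

Definition exchange_ring :=
  forall a, exists e, [/\ is_idempotent e,
    in_right_principal_ideal a e & in_right_principal_ideal (1 - a) (1 - e)].

End RingNotions.

Arguments abelian_ring : clear implicits.
Arguments exchange_ring : clear implicits.

Definition ring_isomorphic (R S : pzRingType) :=
  exists f : {rmorphism R -> S}, bijective f.

(* [Quotient.quot] carries a multiplication only for proper ideals of nontrivial
   commutative rings; [factor_ring] is the same additive quotient with the
   multiplication induced by an arbitrary two-sided ideal. Membership in a
   [twoSidedIdeal] is boolean; classically every two-sided ideal has this form. *)

HB.mixin Record isTwoSidedMulClosed (R : pzRingType) (S : R -> bool) := {
  ideal_mull : forall a x : R, x \in S -> a * x \in S;
  ideal_mulr : forall a x : R, x \in S -> x * a \in S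
}.

#[short(type="twoSidedIdeal")]
HB.structure Definition TwoSidedIdeal (R : pzRingType) :=
  {S of GRing.ZmodClosed R S & isTwoSidedMulClosed R S}.

Definition factor_ring (R : pzRingType) (I : twoSidedIdeal R) : Type :=
  Quotient.quot I.

Section FactorRing.
Variables (R : pzRingType) (I : twoSidedIdeal R).
Local Notation Q := (factor_ring I).

HB.instance Definition _ := GRing.Zmodule.copy Q (Quotient.quot I).

Definition factor_one : Q := \pi_(Quotient.quot I) 1.
Definition factor_mul (x y : Q) : Q :=
  \pi_(Quotient.quot I)
    (repr (x : Quotient.quot I) * repr (y : Quotient.quot I)).

Local Notation pi := (\pi_(Quotient.quot I) : R -> Q).

Lemma factor_piP (x : Q) : exists a, x = pi a.
Proof. by exists (repr (x : Quotient.quot I)); rewrite reprK. Qed.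

Lemma factor_pi_eq (a b : R) : (pi a = pi b) <-> (a - b \in I).
Proof. by rewrite Quotient.idealrBE; split=> [->|/eqP]. Qed.

Lemma factor_piD (a b : R) : pi a + pi b = pi (a + b).
Proof. exact/esym/(Quotient.pi_add I a b). Qed.

Lemma factor_piM (a b : R) : factor_mul (pi a) (pi b) = pi (a * b).
Proof.
rewrite /factor_mul; set a' := repr _; set b' := repr _.
have Ia : a' - a \in I by apply/factor_pi_eq; rewrite /a' reprK.
have Ib : b' - b \in I by apply/factor_pi_eq; rewrite /b' reprK.
apply/factor_pi_eq.
have -> : a' * b' - a * b = a' * (b' - b) + (a' - a) * b.
  by rewrite mulrBr mulrBl addrA subrK.
by apply: rpredD; [exact: ideal_mull | exact: ideal_mulr].
Qed.

Lemma factor_mulA : associative factor_mul.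
Proof.
move=> x y z; have [a ->] := factor_piP x; have [b ->] := factor_piP y.
by have [c ->] := factor_piP z; rewrite !factor_piM mulrA.
Qed.

Lemma factor_mul1 : left_id factor_one factor_mul.
Proof. by move=> x; have [a ->] := factor_piP x; rewrite factor_piM mul1r. Qed.

Lemma factor_mulr1 : right_id factor_one factor_mul.
Proof. by move=> x; have [a ->] := factor_piP x; rewrite factor_piM mulr1. Qed.

Lemma factor_mulDl : left_distributive factor_mul +%R.
Proof.
move=> x y z; have [a ->] := factor_piP x; have [b ->] := factor_piP y.
by have [c ->] := factor_piP z; rewrite !(factor_piM, factor_piD) mulrDl.
Qed.

Lemma factor_mulDr : right_distributive factor_mul +%R.
Proof.
move=> x y z; have [a ->] := factor_piP x; have [b ->] := factor_piP y.
by have [c ->] := factor_piP z; rewrite !(factor_piM, factor_piD) mulrDr.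
Qed.

HB.instance Definition _ := GRing.Zmodule_isPzRing.Build Q
  factor_mulA factor_mul1 factor_mulr1 factor_mulDl factor_mulDr.

End FactorRing.

(* [{malg R[G]}] is the additive group of finitely supported functions G -> R,
   [g@_k] the coefficient of k in g, and [<< c *g k >>] the element c k. Its
   library multiplication requires a [monomType], which excludes nontrivial
   groups, and a nontrivial ring R. *)

Definition group_ring (R : pzRingType) (G : groupType) : Type := {malg R[G]}.

Section GroupRing.
Variables (R : pzRingType) (G : groupType).
Local Notation RG := (group_ring R G).
Implicit Types (g : {malg R[G]}) (k : G).
Local Open Scope fset_scope.

HB.instance Definition _ := GRing.Zmodule.on RG.

Definition group_ring_one : RG := << 1 *g 1%g >>.

Definition group_ring_mul (g1 g2 : RG) : RG :=
  \sum_(k1 <- msupp g1) \sum_(k2 <- msupp g2)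
    << g1@_k1 * g2@_k2 *g (k1 * k2)%g >>.

Local Notation "1" := group_ring_one.
Local Notation mul := group_ring_mul.

Lemma group_ring_mulw (d1 d2 : {fset G}) g1 g2 :
  msupp g1 `<=` d1 -> msupp g2 `<=` d2 ->
  mul g1 g2 = \sum_(k1 <- d1) \sum_(k2 <- d2)
    << g1@_k1 * g2@_k2 *g (k1 * k2)%g >>.
Proof.
move=> le_d1 le_d2; rewrite /mul (big_fset_incl _ le_d1) /=.
  apply/eq_bigr=> k1 _; apply/big_fset_incl => // k _ /mcoeff_outdom ->.
  by rewrite mulr0 monalgU0.
move=> k _ /mcoeff_outdom g1k.
by rewrite big1 => // k' _; rewrite g1k mul0r monalgU0.
Qed.

Lemma group_ring_mulDl : left_distributive mul +%R.
Proof.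
move=> g1 g2 g; pose d := msupp g1 `|` msupp g2.
rewrite (group_ring_mulw (msuppD_le g1 g2) (fsubset_refl _)).
rewrite (group_ring_mulw (fsubsetUl _ (msupp g2)) (fsubset_refl _)).
rewrite (group_ring_mulw (fsubsetUr (msupp g1) _) (fsubset_refl _)).
rewrite -big_split /=; apply/eq_bigr=> k1 _.
rewrite -big_split /=; apply/eq_bigr=> k2 _.
by rewrite mcoeffD mulrDl monalgUD.
Qed.

Lemma group_ring_mulDr : right_distributive mul +%R.
Proof.
move=> g g1 g2.
rewrite (group_ring_mulw (fsubset_refl _) (msuppD_le g1 g2)).
rewrite (group_ring_mulw (fsubset_refl _) (fsubsetUl _ (msupp g2))).
rewrite (group_ring_mulw (fsubset_refl _) (fsubsetUr (msupp g1) _)).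
rewrite -big_split /=; apply/eq_bigr=> k1 _.
rewrite -big_split /=; apply/eq_bigr=> k2 _.
by rewrite mcoeffD mulrDr monalgUD.
Qed.

Lemma group_ring_mulUU c1 c2 k1 k2 :
  mul << c1 *g k1 >> << c2 *g k2 >> = << c1 * c2 *g (k1 * k2)%g >>.
Proof. by rewrite (group_ring_mulw msuppU_le msuppU_le) !big_seq_fset1 !mcoeffUU. Qed.

Lemma group_ring_mul0l g : mul 0 g = 0.
Proof. by rewrite /mul msupp0 big_seq_fset0. Qed.

Lemma group_ring_mul0r g : mul g 0 = 0.
Proof.
by rewrite /mul msupp0; apply: big1 => k _; rewrite big_seq_fset0.
Qed.

Lemma group_ring_suml g (r : seq G) (F : G -> RG) :
  mul (\sum_(k <- r) F k) g = \sum_(k <- r) mul (F k) g.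
Proof.
exact: (big_morph (mul^~ g) (fun _ _ => group_ring_mulDl _ _ _)
  (group_ring_mul0l g)).
Qed.

Lemma group_ring_sumr g (r : seq G) (F : G -> RG) :
  mul g (\sum_(k <- r) F k) = \sum_(k <- r) mul g (F k).
Proof.
exact: (big_morph (mul g) (fun _ _ => group_ring_mulDr _ _ _)
  (group_ring_mul0r g)).
Qed.

Lemma group_ring_mulA : associative mul.
Proof.
move=> g1 g2 g3; rewrite [g1]monalgE (group_ring_suml g2).
rewrite (group_ring_suml (mul g2 g3)) (group_ring_suml g3).
apply: eq_bigr => k1 _.
have := group_ring_mulUU g1@_k1 ^~ k1; set u := << g1@_k1 *g k1 >> => uU.
rewrite [g2]monalgE (group_ring_suml g3) !(group_ring_sumr u).
rewrite (group_ring_suml g3); apply: eq_bigr => k2 _.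
rewrite uU [g3]monalgE (group_ring_sumr << _ *g k2 >>) (group_ring_sumr u).
rewrite group_ring_sumr; apply: eq_bigr => k3 _.
by rewrite !group_ring_mulUU mulrA mulgA.
Qed.

Lemma group_ring_mul1l : left_id 1 mul.
Proof.
move=> g; rewrite [g]monalgE group_ring_sumr; apply: eq_bigr => k _.
by rewrite group_ring_mulUU mul1r mul1g.
Qed.

Lemma group_ring_mul1r : right_id 1 mul.
Proof.
move=> g; rewrite [g]monalgE group_ring_suml; apply: eq_bigr => k _.
by rewrite group_ring_mulUU mulr1 mulg1.
Qed.

HB.instance Definition _ := GRing.Zmodule_isPzRing.Build RG
  group_ring_mulA group_ring_mul1l group_ring_mul1r
  group_ring_mulDl group_ring_mulDr.

End GroupRing.

Section LocallyFinite.
Variable G : groupType.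
Local Open Scope classical_set_scope.

Definition is_subgroup (H : set G) :=
  [/\ H 1%g, forall x y, H x -> H y -> H (x * y)%g
    & forall x, H x -> H x^-1%g].

Definition generated_subgroup (A : set G) : set G := smallest is_subgroup A.

Definition finitely_generated (H : set G) :=
  exists2 A : set G, finite_set A & H = generated_subgroup A.

Definition locally_finite :=
  forall H : set G, is_subgroup H -> finitely_generated H -> finite_set H.

End LocallyFinite.

Arguments locally_finite : clear implicits.

(* Main.v *)
Require Import Defs.
From HB Require Import structures.
From mathcomp Require Import all_boot all_algebra finfield finmap.
From mathcomp Require Import boolp classical_sets cardinality.
From mathcomp.multinomials Require Import monalg.

Set Implicit Arguments.
Unset Strict Implicit.
Unset Printing Implicit Defensive.

Import GRing.Theory.

Local Open Scope ring_scope.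

(** Only the passage from the absence of a factor F_2 to the decomposition of
    every element of RG is substantial: augmentation sends RG to R, and 1 is
    not a sum of two units in F_2 because 1 + 1 = 0 there.

    Let x be in RG. Its support generates a finite subgroup H, so x lies in the
    subring A of elements supported on H. This A is spanned over the image of R
    by finitely many elements commuting with that image; the argument concerns
    any ring of this kind ([sum_of_two_units_spanned]).

    Assume that x is not a sum of two units of A. Being a sum of two units
    modulo an ideal involves finitely many memberships, so Zorn's lemma gives an
    ideal maximal among those modulo which x is bad; the quotient by it is still
    spanned in the same way, so A may be replaced by it
    ([exists_critical_factor]). Now x is bad in A but good modulo every nonzero
    ideal, and this rigidity replaces the structure theory. A nontrivial central
    idempotent would split A into two good pieces; an ideal J such that 1 + J
    consists of left invertible elements would allow units to be lifted. Hence
    the central idempotents of A are 0 and 1, and A has no such J but 0.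

    The exchange property provides, for each r in R, an idempotent of R that is
    central because R is Abelian, so it becomes 0 or 1 in A: the image of R is a
    local ring. Nakayama's argument shows that its nonunits generate an ideal J
    as above ([nonunit_comb_quasiregular]); so the image of R is a division ring
    D, and A is finite dimensional over D. Thus left ideals of A have bounded
    length, A is semiprime, every two-sided ideal is generated by a central
    idempotent, and A is simple.

    In a simple ring of finite length in which no corner eAe at a minimal
    idempotent e is {0, e}, every element x is a sum of two units
    ([sum_of_two_units_simple]). One builds u along an increasing chain of
    idempotents f, keeping right multiplication by u and by x - u injective on
    Af. One more simple summand Ae is added by choosing the value g of u on it
    outside one proper subspace of eA and outside a translate of another one,
    which is possible as soon as the division ring eAe has more than two
    elements.

    If some eAe were {0, e}, then 1 would be a finite sum of elements a e b and
    A would be finite. Then D is finite, hence commutative by Wedderburn's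
    theorem, hence central in A, hence embedded in eAe = {0, e}: D is F_2, a
    factor ring of R, which is excluded. *)

(** * Ideals and minimal idempotents *)

Lemma exists_minimizer (T : Type) (P : T -> Prop) (f : T -> nat) :
  (exists x, P x) -> exists2 x, P x & forall y, P y -> (f x <= f y)%N.
Proof.
case=> x0 Px0; pose Q n := `[< exists2 x, P x & f x = n >].
have exQ : exists n, Q n by exists (f x0); apply/asboolP; exists x0.
case: (ex_minnP exQ) => n /asboolP[x Px <-] min_x.
by exists x => // y Py; apply: min_x; apply/asboolP; exists y.
Qed.

Section Ideals.

Variable A : pzRingType.
Implicit Types (a b c e f g u v x y z : A) (L N J : A -> Prop).

Definition left_ideal L :=
  [/\ L 0, forall a b, L a -> L b -> L (a + b) & forall c a, L a -> L (c * a)].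

Definition two_sided_ideal J := left_ideal J /\ forall a c, J a -> J (a * c).

Definition left_multiples b : A -> Prop := fun a => exists c, a = c * b.

Lemma left_multiples_ideal b : left_ideal (left_multiples b).
Proof.
split; first by exists 0; rewrite mul0r.
  by move=> _ _ [c ->] [d ->]; exists (c + d); rewrite mulrDl.
by move=> c _ [d ->]; exists (c * d); rewrite mulrA.
Qed.

Lemma left_idealN L a : left_ideal L -> L a -> L (- a).
Proof. by case=> _ _ LM La; rewrite -mulN1r; apply: LM. Qed.

Lemma left_idealB L a b : left_ideal L -> L a -> L b -> L (a - b).
Proof. by move=> idL La Lb; case: (idL) => _ + _; apply=> //; apply: left_idealN. Qed.

Lemma left_ideal_sum L (I : Type) (s : seq I) (F : I -> A) :
  left_ideal L -> (forall i, L (F i)) -> L (\sum_(i <- s) F i).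
Proof. by case=> L0 LD _ LF; apply: big_ind. Qed.

Definition ideal_generated a : A -> Prop :=
  fun z => exists s : seq (A * A), z = \sum_(p <- s) p.1 * a * p.2.

Lemma ideal_generated_ideal a : two_sided_ideal (ideal_generated a).
Proof.
split; first split.
- by exists [::]; rewrite big_nil.
- by move=> _ _ [s ->] [t ->]; exists (s ++ t); rewrite big_cat.
- move=> c _ [s ->]; exists [seq (c * p.1, p.2) | p <- s].
  by rewrite big_map mulr_sumr; apply: eq_bigr => p _; rewrite !mulrA.
- move=> _ c [s ->]; exists [seq (p.1, p.2 * c) | p <- s].
  by rewrite big_map mulr_suml; apply: eq_bigr => p _; rewrite !mulrA.
Qed.

Lemma ideal_generated_self a : ideal_generated a a.
Proof. by exists [:: (1, 1)]; rewrite big_seq1 mul1r mulr1. Qed.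

(** A length function without composition series: all that descending chain
    arguments need is that a proper inclusion of left ideals strictly increases
    a natural number. *)
Definition left_length (len : (A -> Prop) -> nat) :=
  forall L N, left_ideal L -> left_ideal N -> (forall a, L a -> N a) ->
  (len N <= len L)%N -> forall a, N a -> L a.

Definition semiprime := forall a, (forall b, a * b * a = 0) -> a = 0.

(** The last clause says that the left ideal Ae is simple; it is what makes eAe
    a division ring. *)
Definition minimal_idempotent e :=
  [/\ is_idempotent e, e <> 0 & forall b, b * e <> 0 -> exists c, c * (b * e) = e].

End Ideals.

Section FiniteLength.

Variables (A : pzRingType) (len : (A -> Prop) -> nat).
Hypothesis len_mono : left_length len.
Implicit Types (a b c e f g u v x y z : A) (L N J : A -> Prop).

Lemma left_multiples_len a d :
  (len (left_multiples a) <= len (left_multiples (d * a)))%N ->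
  exists c, a = c * (d * a).
Proof.
move=> le_len; apply: (len_mono (left_multiples_ideal (d * a))
  (left_multiples_ideal a) _ le_len); last by exists 1; rewrite mul1r.
by move=> _ [c ->]; exists (c * d); rewrite mulrA.
Qed.

(** Fitting's argument: the chain of left ideals A u^k stabilizes, u^k = b u^(k+1),
    and cancelling u^k on the right gives b u = 1. *)
Lemma is_unit_of_injective u : (forall a, a * u = 0 -> a = 0) -> is_unit u.
Proof.
move=> inj_u.
have [k _ min_k] := @exists_minimizer nat (fun=> True)
  (fun k => len (left_multiples (u ^+ k))) (ex_intro _ 0%N I).
have [|b def_uk] := @left_multiples_len (u ^+ k) u.
  by rewrite -exprS; apply: min_k.
have inj_uk m a : a * u ^+ m = 0 -> a = 0.
  by elim: m a => [a|m IHm a]; rewrite ?mulr1 // exprSr mulrA => /inj_u /IHm.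
have bu1 : b * u = 1.
  apply/esym/eqP; rewrite -subr_eq0; apply/eqP/(inj_uk k).
  by rewrite mulrBl mul1r -mulrA -def_uk subrr.
exists b; split=> //; apply/eqP; rewrite -subr_eq0; apply/eqP/inj_u.
by rewrite mulrBl mul1r -mulrA bu1 mulr1 subrr.
Qed.

Lemma left_inverse_right a b : a * b = 1 -> b * a = 1.
Proof.
move=> ab1; have [c ca0|c [ac1 ca1]] := @is_unit_of_injective a.
  by rewrite -[c]mulr1 -ab1 mulrA ca0 mul0r.
by rewrite -[b]mul1r -ca1 -(mulrA c) ab1 mulr1.
Qed.

Hypothesis A_semiprime : semiprime A.

(** Brauer's lemma. A nonzero left ideal Aa of least length is simple, and by
    semiprimeness p = ba satisfies a p <> 0 for some b, so right multiplication
    by p is bijective on Aa; the element e of Aa with e p = p is idempotent,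
    because nothing nonzero in Aa annihilates p. *)
Lemma exists_minimal_idempotent N a :
  left_ideal N -> N a -> a <> 0 -> exists2 e, N e & minimal_idempotent e.
Proof.
move=> idN Na nz_a; have [_ _ NM] := idN.
have [|{Na nz_a}a [Na nz_a] min_a] := @exists_minimizer A
  (fun a => N a /\ a <> 0) (fun a => len (left_multiples a)).
  by exists a.
have absorb b : b * a <> 0 -> exists c, c * (b * a) = a.
  move=> nz_ba; have [|c def_a] := @left_multiples_len a b; last by exists c.
  by apply: min_a; split=> //; apply: NM.
have [b nz_aba] : exists b, a * b * a <> 0.
  by apply: contrapT => /forallNP nz; apply: nz_a; apply: A_semiprime => b;
     apply: contrapT; apply: nz.
have [c def_a] := absorb _ nz_aba.
pose p := b * a; pose e := b * c * a.
have ep : e * p = p by rewrite /e /p -[in RHS]def_a !mulrA.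
have ann_p d : d * a * p = 0 -> d * a = 0.
  move=> dap0; apply: contrapT => /absorb[d' def_a']; apply: nz_aba.
  by rewrite -mulrA -/p -def_a' -mulrA dap0 mulr0.
have ee : e * e = e.
  apply/eqP; rewrite -subr_eq0; apply/eqP.
  have -> : e * e - e = (e * b * c - b * c) * a by rewrite mulrBl /e !mulrA.
  by apply: ann_p; rewrite mulrBl -/e -!(mulrA e) -/e mulrBl -mulrA !ep subrr.
have nz_e : e <> 0.
  by move=> e0; apply: nz_aba; rewrite -mulrA -/p -ep e0 mul0r mulr0.
exists e; first exact: NM.
split=> // d; rewrite /e => nz_de.
have /absorb[c'] : d * (b * c) * a <> 0 by rewrite -mulrA.
by move=> def_a'; exists (b * c * c'); rewrite -{2}def_a' !mulrA.
Qed.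

(** Choose an idempotent e of J whose left annihilator in J is as small as
    possible. Were that annihilator nonzero, it would contain an idempotent e0,
    and e + e0 - e e0 would do better; so J = Ae. As J also absorbs on the right,
    ea = eae for every a, and t = ae - eae satisfies tAt = 0; semiprimeness gives
    t = 0, so that e is central. *)
Lemma two_sided_ideal_central_idempotent J :
  two_sided_ideal J ->
  exists e, [/\ J e, is_idempotent e, forall a, GRing.comm e a
               & forall a, J a -> a * e = a].
Proof.
move=> [idJ JMr]; have [J0 JD JM] := idJ.
pose ann e a := J a /\ a * e = 0.
have id_ann e : left_ideal (ann e).
  split; first by split; rewrite ?mul0r.
    by move=> a b [Ja ae] [Jb be]; split; [exact: JD | rewrite mulrDl ae be addr0].
  by move=> c a [Ja ae]; split; [exact: JM | rewrite -mulrA ae mulr0].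
have [|e [Je ee] min_e] := @exists_minimizer A
  (fun e => J e /\ e * e = e) (fun e => len (ann e)).
  by exists 0; rewrite mul0r.
have Je_id a : J a -> a * e = a.
  move=> Ja; apply/esym/eqP; rewrite -subr_eq0; apply/eqP; apply: contrapT.
  have ann_a : ann e (a - a * e).
    by split; [apply: left_idealB => //; apply: JM | rewrite mulrBl -mulrA ee subrr].
  move=> /(exists_minimal_idempotent (id_ann e) ann_a)[e0 [Je0 e0e] [ee0 nz_e0 _]].
  pose e' := e + e0 - e * e0.
  have e'e : e' * e = e by rewrite mulrBl mulrDl ee -mulrA e0e mulr0 subr0 addr0.
  have e'e0 : e' * e0 = e0 by rewrite mulrBl mulrDl -mulrA ee0 addrAC subrr add0r.
  have e'e' : e' * e' = e'.
    by rewrite {2}/e' mulrBr mulrDr e'e e'e0 mulrA e'e.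
  have Je' : J e' by apply: left_idealB => //; [apply: JD | apply: JM].
  have [|_ e0e'] := len_mono (id_ann e') (id_ann e) _ (min_e e' (conj Je' e'e'))
    (conj Je0 e0e).
    by move=> a0 [Ja0 a0e']; split=> //; rewrite -e'e mulrA a0e' mul0r.
  by apply: nz_e0; rewrite -e0e' /e' mulrBr mulrDr mulrA e0e ee0 mul0r subr0 add0r.
exists e; split=> // a; rewrite /GRing.comm.
have eae : e * a * e = e * a by apply: Je_id; apply: JMr.
rewrite -eae; apply/esym/eqP; rewrite -subr_eq0; apply/eqP/A_semiprime => b.
set t := _ - _.
have Jt : J t by apply: left_idealB => //; [|rewrite -mulrA]; do !apply/JM.
have et0 : e * t = 0 by rewrite mulrBr !mulrA ee subrr.
by rewrite -(Je_id (t * b) (JMr _ _ Jt)) -mulrA et0 mulr0.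
Qed.

Hypothesis A_simple : forall a, a <> 0 -> ideal_generated a 1.

(** In a simple ring AeA = A, so a left ideal that contains eA is everything. *)
Lemma left_ideal_avoids N e :
  left_ideal N -> e <> 0 -> ~ N 1 -> exists p, ~ N (e * p).
Proof.
move=> idN nz_e N1; apply: contrapT => /forallNP Ne.
apply: N1; have [s ->] := A_simple nz_e.
apply: (left_ideal_sum _ idN) => p; have [_ _ NM] := idN.
by rewrite -mulrA; apply: NM; apply: contrapT; apply: Ne.
Qed.

(** In the vector space eA over the division ring eAe, a proper subspace and a
    translate of a proper subspace do not cover everything unless eAe has two
    elements. If they did, comparing p with dp for p outside N1 would put p, and
    then y, in N2, and comparing y + q with y + dq for q outside N2 would put q
    in N1; but then p + q is not covered. *)
Lemma avoid_two_left_ideals N1 N2 e d y :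
  left_ideal N1 -> left_ideal N2 -> minimal_idempotent e ->
  e * d = d -> d * e = d -> d <> 0 -> d <> e -> ~ N1 1 -> ~ N2 1 ->
  exists g, ~ N1 (e * g) /\ ~ N2 (e * (y - g)).
Proof.
move=> idN1 idN2 [ee nz_e min_e] ed de nz_d d_e N1_1 N2_1.
have [p N1p] := left_ideal_avoids idN1 nz_e N1_1.
have [q N2q] := left_ideal_avoids idN2 nz_e N2_1.
have scale N c a : left_ideal N -> c * e = c -> c <> 0 -> N (c * a) -> N (e * a).
  move=> [_ _ NM] ce nz_c Nca.
  have [|w] := min_e c; first by rewrite ce.
  by rewrite ce => <-; rewrite -mulrA; apply: NM.
have ed_e : (e - d) * e = e - d by rewrite mulrBl ee de.
have nz_ed : e - d <> 0 by move/eqP; rewrite subr_eq0 eq_sym => /eqP.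
have scale2 N a : left_ideal N -> N (e * a - d * a) -> N (e * a).
  by move=> idN; rewrite -mulrBl; apply: scale.
apply: contrapT => /forallNP no_g.
have N12 g : ~ N1 (e * g) -> N2 (e * (y - g)).
  by move=> N1g; apply: contrapT => N2g; apply: (no_g g).
have N2B g h : N2 (e * (y - g)) -> N2 (e * (y - h)) -> N2 (e * h - e * g).
  move=> N2g N2h; rewrite -mulrBr.
  have -> : h - g = (y - g) - (y - h) by rewrite opprB addrCA [y - g]addrC addrK.
  by rewrite mulrBr; apply: left_idealB.
have N2p : N2 (e * p).
  apply: (scale2 _ _ idN2); rewrite -[in d * p]ed -mulrA.
  apply: N2B; apply: N12 => //; rewrite mulrA ed => /(scale _ _ _ idN1 de nz_d).
  exact: N1p.
have N2y : N2 (e * y).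
  have [_ N2D _] := idN2; rewrite -(subrK p y) mulrDr; apply: N2D => //.
  exact: N12.
have N1q : N1 (e * q).
  have N1yq c : e * c = c -> c * e = c -> c <> 0 -> N1 (e * y + c * q).
    move=> ec ce nz_c; apply: contrapT => N1g; apply/N2q/(scale _ _ _ idN2 ce nz_c).
    have := N12 (y + c * q); rewrite mulrDr mulrA ec => /(_ N1g).
    rewrite opprD addNKr mulrN mulrA ec => /(left_idealN idN2).
    by rewrite opprK.
  apply: (scale2 _ _ idN1); have := left_idealB idN1 (N1yq e ee ee nz_e) (N1yq d ed de nz_d).
  by rewrite opprD addrACA subrr add0r.
have N1pq : ~ N1 (e * (p + q)).
  rewrite mulrDr => /(left_idealB idN1)/(_ N1q); rewrite addrK; exact: N1p.
apply: N2q; have := left_idealB idN2 N2y (N12 _ N1pq).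
rewrite -mulrBr opprB addrC subrK mulrDr => /(left_idealB idN2)/(_ N2p).
by rewrite addrC addKr.
Qed.

Hypothesis big_corners : forall e, minimal_idempotent e ->
  exists d, [/\ e * d = d, d * e = d, d <> 0 & d <> e].

(** A partial solution (f, u) has f idempotent, u in fA, and right multiplications
    by u and x - u injective on Af. One with A(1 - f) of least length has f = 1:
    otherwise A(1 - f) contains a minimal idempotent, which can be made
    orthogonal to f, and the solution extends to f + e. *)
Lemma sum_of_two_units_simple x : sum_of_two_units x.
Proof.
pose injective_on f v := forall a, a * v = 0 -> a * f = 0.
pose partial f u := [/\ f * f = f, f * u = u,
  injective_on f u & injective_on f (f * x - u)].
have [|[f u] /= [ff fu inj_u inj_xu] min_f] := @exists_minimizer (A * A)
  (fun p => partial p.1 p.2) (fun p => len (left_multiples (1 - p.1))).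
  by exists (0, 0); split; rewrite ?mulr0 // => a _; rewrite mulr0.
have [f1|f_neq1] := pselect (f = 1).
  exists u, (x - u); split; last by rewrite addrC subrK.
    by apply: is_unit_of_injective => a /inj_u; rewrite f1 mulr1.
  apply: is_unit_of_injective => a au0; rewrite -[a]mulr1 -f1.
  by apply: inj_xu; rewrite f1 mul1r.
(* Finite length makes one-sided inverses two-sided: w v = 1 would give v w = 1,
   whence f = f v w = 1. *)
have proper v : f * v = v -> ~ left_multiples v 1.
  move=> fv [w /esym/left_inverse_right vw1]; apply: f_neq1.
  by rewrite -[f]mulr1 -vw1 mulrA fv.
have fxu : f * (f * x - u) = f * x - u by rewrite mulrBr mulrA ff fu.
have nz_f' : 1 - f <> 0 by move/eqP; rewrite subr_eq0 eq_sym => /eqP.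
have ideal_f' := left_multiples_ideal (1 - f).
have [|e0 [c0 def_e0] min_e0] := exists_minimal_idempotent ideal_f' _ nz_f'.
  by exists 1; rewrite mul1r.
have e0f : e0 * f = 0 by rewrite def_e0 -mulrA mulrBl mul1r ff subrr mulr0.
have [ee0 nz_e0 absorb_e0] := min_e0.
(* e0 satisfies e0 f = 0; multiplying by 1 - f on the left gives f e = 0 too. *)
pose e := (1 - f) * e0.
have fe : f * e = 0 by rewrite mulrA mulrBr mulr1 ff subrr mul0r.
have ef : e * f = 0 by rewrite -mulrA e0f mulr0.
have e0e : e0 * e = e0 by rewrite mulrA mulrBr mulr1 e0f subr0 ee0.
have ee : e * e = e by rewrite -[LHS]mulrA e0e.
have nz_e : e <> 0 by move=> e_0; apply: nz_e0; rewrite -e0e e_0 mulr0.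
have min_e : minimal_idempotent e.
  split=> // b; rewrite {1}/e mulrA => /absorb_e0[c].
  by rewrite -mulrA -/e => def; exists ((1 - f) * c); rewrite -mulrA def.
have [d [ed de nz_d d_e]] := big_corners min_e.
have [g [N1g N2g]] := avoid_two_left_ideals x (left_multiples_ideal u)
  (left_multiples_ideal (f * x - u)) min_e ed de nz_d d_e
  (proper u fu) (proper _ fxu).
have extend v w : f * v = v -> injective_on f v ->
    ~ left_multiples v (e * w) -> injective_on (f + e) (v + e * w).
  move=> fv inj_v vw a; rewrite mulrDr => avw0.
  have ae0 : a * e = 0.
    apply: contrapT => nz_ae; have [_ _ /(_ a nz_ae)[c cae]] := min_e.
    apply: vw; exists (- (c * a)).
    move/eqP: avw0; rewrite addrC addr_eq0 => /eqP avw.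
    by rewrite -[e in LHS]cae -mulrA -(mulrA a) avw mulrN mulNr mulrA.
  by rewrite mulrDr ae0 addr0; apply: inj_v; rewrite -avw0 mulrA ae0 mul0r addr0.
have Pfe : partial (f + e) (u + e * g).
  split.
  - by rewrite mulrDl !mulrDr ff fe ef ee addr0 add0r.
  - rewrite mulrDl !mulrDr mulrA fe mul0r addr0 fu mulrA ee -fu mulrA ef.
    by rewrite mul0r add0r.
  - exact: extend.
  - have -> : (f + e) * x - (u + e * g) = f * x - u + e * (x - g).
      by rewrite mulrDl mulrBr opprD addrACA.
    exact: extend.
have := min_f (f + e, u + e * g) Pfe => /=.
have -> : 1 - (f + e) = (1 - e) * (1 - f).
  by rewrite mulrBl mul1r mulrBr mulr1 ef subr0 opprD addrA.
case/left_multiples_len => c def_f'; exfalso; apply: nz_e.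
have := congr1 (fun z => z * e) def_f'.
rewrite -!mulrA mulrBl mul1r fe subr0 => ->.
by rewrite mulrBl mul1r ee subrr mulr0.
Qed.

End FiniteLength.

(** * Lifting units, and a maximal counterexample *)

Section UnitsModuloIdeals.

Variable A : pzRingType.
Implicit Types (a b c e u v x y z : A) (J : A -> Prop).

Definition inverse_mod J u v := J (u * v - 1) /\ J (v * u - 1).

Definition two_units_mod J x :=
  exists u u' v v',
    [/\ inverse_mod J u u', inverse_mod J v v' & J (x - (u + v))].

Lemma two_units_mod_zero x : two_units_mod (eq^~ 0) x -> sum_of_two_units x.
Proof.
have eqB a b : a - b = 0 -> a = b by move/eqP; rewrite subr_eq0 => /eqP.
case=> u [u' [v [v' [[/eqB uu' /eqB u'u] [/eqB vv' /eqB v'v] /eqB def_x]]]].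
by exists u, v; split=> //; [exists u' | exists v'].
Qed.

(** Chinese remaindering: c A and (1 - c) A are complementary ideals, each being
    the annihilator of the other's generator. *)
Lemma two_units_mod_complement c x :
  is_idempotent c -> (forall a, GRing.comm c a) ->
  two_units_mod (fun a => c * a = 0) x ->
  two_units_mod (fun a => (1 - c) * a = 0) x -> sum_of_two_units x.
Proof.
move=> cc c_central [u1 [u1' [v1 [v1' [[uu1 u'u1] [vv1 v'v1] x1]]]]].
move=> [u2 [u2' [v2 [v2' [[uu2 u'u2] [vv2 v'v2] x2]]]]].
pose mix a b := c * a + (1 - c) * b.
have c'c : (1 - c) * c = 0 by rewrite mulrBl mul1r cc subrr.
have cc' : c * (1 - c) = 0 by rewrite mulrBr mulr1 cc subrr.
have c'c' : (1 - c) * (1 - c) = 1 - c by rewrite mulrBr mulr1 c'c subr0.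
have c'_central a : (1 - c) * a = a * (1 - c).
  by rewrite mulrBl mulrBr mulr1 mul1r c_central.
have swap d d' a b : (forall t, d' * t = t * d') ->
    d * a * (d' * b) = d * d' * (a * b).
  by move=> d'_central; rewrite -!mulrA (mulrA a) -d'_central !mulrA.
have mixM a b a' b' : mix a b * mix a' b' = mix (a * a') (b * b').
  rewrite /mix mulrDl !mulrDr (swap c c a a') // (swap c _ a b') //.
  rewrite (swap _ c b a') // (swap _ _ b b') //.
  by rewrite cc cc' c'c c'c' !mul0r addr0 add0r.
have mix1 : mix 1 1 = 1 by rewrite /mix !mulr1 addrC subrK.
have mix_eq a b a' b' : c * (a - a') = 0 -> (1 - c) * (b - b') = 0 ->
    mix a b = mix a' b'.
  by rewrite !mulrBr => /eqP; rewrite subr_eq0 /mix => /eqP -> /eqP;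
     rewrite subr_eq0 => /eqP ->.
exists (mix u1 u2), (mix v1 v2); split.
- by exists (mix u1' u2'); rewrite !mixM -mix1; split; apply: mix_eq.
- by exists (mix v1' v2'); rewrite !mixM -mix1; split; apply: mix_eq.
- transitivity (mix x x); first by rewrite /mix -mulrDl addrC subrK mul1r.
  by rewrite (mix_eq _ _ _ _ x1 x2) /mix !mulrDr addrACA.
Qed.

(** A left inverse y of 1 + z is 1 - y z, hence again in 1 + J and left
    invertible; so 1 + z is a unit. *)
Lemma is_unit_of_mod J u v :
  two_sided_ideal J -> (forall z, J z -> exists y, y * (1 + z) = 1) ->
  inverse_mod J u v -> is_unit u.
Proof.
move=> [idJ _] left_inv [Juv Jvu]; have [_ _ JM] := idJ.
have unit1 z : J z -> is_unit (1 + z).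
  move=> Jz; have [y yz] := left_inv z Jz.
  have [|w wy] := left_inv (- (y * z)); first by apply: left_idealN => //; apply: JM.
  have def_y : 1 - y * z = y by rewrite -yz mulrDr mulr1 addrK.
  move: wy; rewrite def_y => wy; exists y; split=> //.
  suff -> : 1 + z = w by [].
  by rewrite -[LHS]mul1r -{1}wy -mulrA yz mulr1.
have [y []] := unit1 _ Juv; have [w []] := unit1 _ Jvu.
rewrite !(addrCA 1) !subrr !addr0 => _ wvu uvy _.
exists (v * y); rewrite mulrA; split=> //.
suff -> : v * y = w * v by rewrite -mulrA.
by rewrite -[v * y]mul1r -wvu -[w * v]mulr1 -uvy !mulrA.
Qed.

Lemma two_units_lift J x :
  two_sided_ideal J -> (forall z, J z -> exists y, y * (1 + z) = 1) ->
  two_units_mod J x -> sum_of_two_units x.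
Proof.
move=> idJ left_inv [u [u' [v [v' [uu' [vv' v'v] Jx]]]]].
exists u, (x - u); split; last by rewrite addrC subrK.
  exact: is_unit_of_mod uu'.
have [[J0 JD JM] JMr] := idJ.
have Jv : J (x - u - v) by rewrite -addrA -opprD.
apply: (is_unit_of_mod idJ left_inv (v := v')); rewrite -[x - u](subrK v); split.
  by rewrite mulrDl -addrA; apply: JD => //; apply: JMr.
by rewrite mulrDr -addrA; apply: JD => //; apply: JM.
Qed.

(** A counterexample all of whose images in proper quotients are sums of two
    units. *)
Definition critical x :=
  ~ sum_of_two_units x /\
  forall J a, two_sided_ideal J -> J a -> a <> 0 -> two_units_mod J x.

Section Critical.

Variable x : A.
Hypothesis crit_x : critical x.

Lemma critical_nontrivial : 1 <> 0 :> A.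
Proof.
move=> A10; case: crit_x => + _; apply.
have A0 a : a = 0 by rewrite -[a]mul1r A10 mul0r.
by exists 1, 1; split; rewrite ?[x]A0 -?[1 + 1]A0 ?[in RHS]A0 //;
   exists 1; rewrite mulr1.
Qed.

Lemma critical_central_idempotent c :
  is_idempotent c -> (forall a, GRing.comm c a) -> c = 0 \/ c = 1.
Proof.
move=> cc c_central; have [bad good] := crit_x.
have central_annihilator d : (forall a, GRing.comm d a) ->
    two_sided_ideal (fun a => d * a = 0).
  move=> d_central; split; first split; first exact: mulr0.
  - by move=> a b da db; rewrite mulrDr da db addr0.
  - by move=> b a da; rewrite mulrA d_central -mulrA da mulr0.
  - by move=> a b da; rewrite mulrA da mul0r.
have [c1|c_neq1] := pselect (c = 1); first by right.
have [c0|nz_c] := pselect (c = 0); first by left.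
have c'_central a : GRing.comm (1 - c) a.
  by rewrite /GRing.comm mulrBl mulrBr mulr1 mul1r c_central.
case: bad; apply: (two_units_mod_complement cc c_central).
  apply: (good _ (1 - c) (central_annihilator _ c_central)).
    by rewrite mulrBr mulr1 cc subrr.
  by move/eqP; rewrite subr_eq0 eq_sym => /eqP.
apply: (good _ c (central_annihilator _ c'_central)) => //.
by rewrite mulrBl mul1r cc subrr.
Qed.

Lemma critical_quasiregular_ideal J a :
  two_sided_ideal J -> (forall z, J z -> exists y, y * (1 + z) = 1) ->
  J a -> a = 0.
Proof.
move=> idJ left_inv Ja; apply: contrapT => nz_a; have [bad good] := crit_x.
exact/bad/(two_units_lift idJ left_inv)/(good J a).
Qed.

Lemma critical_semiprime : semiprime A.
Proof.
move=> a aAa; have idJ := ideal_generated_ideal a.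
apply: (critical_quasiregular_ideal idJ _ (ideal_generated_self a)) => _ [s ->].
set z := \sum_(p <- s) _; have zz : z * z = 0.
  rewrite mulr_suml big1 // => p _; rewrite mulr_sumr big1 // => q _.
  by rewrite !mulrA -(mulrA _ p.2) -(mulrA p.1) -(mulrA p.1) aAa mulr0 mul0r.
by exists (1 - z); rewrite mulrBl mul1r mulrDr mulr1 zz addr0 addrK.
Qed.

Lemma critical_simple len : left_length (A := A) len ->
  forall a, a <> 0 -> ideal_generated a 1.
Proof.
move=> len_mono a nz_a; have idJ := ideal_generated_ideal a.
have [e [Je ee e_central e_id]] :=
  two_sided_ideal_central_idempotent len_mono critical_semiprime idJ.
have [e0|<- //] := critical_central_idempotent ee e_central.
by case: nz_a; rewrite -(e_id a (ideal_generated_self a)) e0 mulr0.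
Qed.

End Critical.

End UnitsModuloIdeals.

Section FactorRings.

Local Open Scope quotient_scope.

Variable A : pzRingType.

(** The argument [idJ] lets the closure properties of J be attached to the
    predicate as canonical structures. *)
Definition ideal_pred (J : A -> Prop) (idJ : two_sided_ideal J) : A -> bool :=
  fun a => `[< J a >].

Section IdealPred.

Variables (J : A -> Prop) (idJ : two_sided_ideal J).

Lemma ideal_pred_zmod_closed : zmod_closed (ideal_pred idJ).
Proof.
split; first by have [[J0 _ _] _] := idJ; apply/asboolP.
by move=> a b /asboolP Ja /asboolP Jb; apply/asboolP/(left_idealB idJ.1).
Qed.

Lemma ideal_pred_mull a b : b \in ideal_pred idJ -> a * b \in ideal_pred idJ.
Proof. by have [[_ _ JM] _] := idJ; move=> /asboolP Jb; apply/asboolP; apply: JM. Qed.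

Lemma ideal_pred_mulr a b : b \in ideal_pred idJ -> b * a \in ideal_pred idJ.
Proof. by have [_ JMr] := idJ; move=> /asboolP Jb; apply/asboolP; apply: JMr. Qed.

HB.instance Definition _ :=
  GRing.isZmodClosed.Build A (ideal_pred idJ) ideal_pred_zmod_closed.
HB.instance Definition _ :=
  isTwoSidedMulClosed.Build A (ideal_pred idJ) ideal_pred_mull ideal_pred_mulr.

Definition ideal_of : twoSidedIdeal A := TwoSidedIdeal.clone A (ideal_pred idJ) _.

Lemma in_ideal_of a : a \in ideal_of <-> J a.
Proof. by split=> [/asboolP|Ja]; last apply/asboolP. Qed.

End IdealPred.

Section Projection.

Variable I : twoSidedIdeal A.

Definition factor_proj : A -> factor_ring I := \pi_(Quotient.quot I).

Lemma factor_proj_is_zmod_morphism : zmod_morphism factor_proj.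
Proof.
move=> a b; rewrite /factor_proj -[in LHS](factor_piD I).
by congr (_ + _); exact: (Quotient.pi_opp I b).
Qed.

Lemma factor_proj_is_monoid_morphism : monoid_morphism factor_proj.
Proof. by split=> // a b; rewrite /factor_proj -(factor_piM I). Qed.

HB.instance Definition _ :=
  GRing.isZmodMorphism.Build A (factor_ring I) factor_proj
    factor_proj_is_zmod_morphism.
HB.instance Definition _ :=
  GRing.isMonoidMorphism.Build A (factor_ring I) factor_proj
    factor_proj_is_monoid_morphism.

Lemma factor_proj_surj (y : factor_ring I) : exists a, y = factor_proj a.
Proof. exact: factor_piP. Qed.

Lemma factor_proj_eq0 a : factor_proj a = 0 <-> a \in I.
Proof.
by have := factor_pi_eq I a 0; rewrite subr0 -/factor_proj rmorph0.
Qed.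

End Projection.

Lemma factor_proj_eq I a b : factor_proj I a = factor_proj I b <-> a - b \in I.
Proof. exact: factor_pi_eq. Qed.

Lemma sum_of_two_units_factor J (idJ : two_sided_ideal J) x :
  sum_of_two_units (factor_proj (ideal_of idJ) x) -> two_units_mod J x.
Proof.
have pJ a b : factor_proj (ideal_of idJ) a = factor_proj (ideal_of idJ) b ->
    J (a - b) by move=> /factor_proj_eq/in_ideal_of.
have unit_lift y : is_unit y ->
    exists u u', y = factor_proj (ideal_of idJ) u /\ inverse_mod J u u'.
  case=> y' []; have [u ->] := factor_proj_surj y.
  have [u' ->] := factor_proj_surj y' => uu' u'u.
  by exists u, u'; split=> //; split; apply: pJ; rewrite rmorphM rmorph1.
case=> _ [_ [/unit_lift[u [u' [-> uu']]] /unit_lift[v [v' [-> vv']]] def_x]].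
by exists u, u', v, v'; split=> //; apply: pJ; rewrite rmorphD.
Qed.

Lemma two_units_mod_preim (I : twoSidedIdeal A) K x :
  two_units_mod (K \o factor_proj I) x -> two_units_mod K (factor_proj I x).
Proof.
have inv u u' : inverse_mod (K \o factor_proj I) u u' ->
    inverse_mod K (factor_proj I u) (factor_proj I u').
  by rewrite /inverse_mod /= !rmorphB !rmorphM rmorph1.
case=> u [u' [v [v' [/inv uu' /inv vv' /= def_x]]]].
exists (factor_proj I u), (factor_proj I u'), (factor_proj I v), (factor_proj I v').
by split=> //; rewrite -rmorphD -rmorphB.
Qed.

Lemma two_sided_ideal_preim (I : twoSidedIdeal A) K :
  two_sided_ideal K -> two_sided_ideal (K \o factor_proj I).
Proof.
case=> [[K0 KD KM] KMr]; split; first split; rewrite /= ?rmorph0 //.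
- by move=> a b Ka Kb; rewrite rmorphD; apply: KD.
- by move=> a b Kb; rewrite rmorphM; apply: KM.
- by move=> a b Ka; rewrite rmorphM; apply: KMr.
Qed.

Lemma two_sided_ideal_zero : two_sided_ideal (fun a : A => a = 0).
Proof.
split; first split=> // [_ _ -> ->|c _ ->]; rewrite ?addr0 ?mulr0 //.
by move=> _ c ->; rewrite mul0r.
Qed.

(** The finite character behind the use of Zorn's lemma. *)
Lemma chain_contains (T : eqType) (F : set (set T)) (s : seq T) X0 :
  total_on F subset -> F X0 -> (forall a, a \in s -> (\bigcup_(X in F) X)%classic a) ->
  exists2 X, F X & forall a, a \in s -> X a.
Proof.
move=> totF FX0; elim: s => [|a s IHs] sF; first by exists X0.
have [|X FX sX] := IHs; first by move=> b sb; apply: sF; rewrite inE sb orbT.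
have [Y FY Ya] := sF a (mem_head _ _).
have [XY|YX] := totF _ _ FX FY.
  by exists Y => // b /predU1P[->|/sX /XY].
by exists X => // b /predU1P[->|/sX //]; apply: YX.
Qed.

(** Zorn's lemma on the ideals modulo which x is not a sum of two units. A good
    decomposition modulo the union of a chain uses five memberships, hence
    already holds modulo one member of the chain. *)
Lemma exists_critical_factor (x : A) :
  ~ sum_of_two_units x ->
  exists I : twoSidedIdeal A, critical (factor_proj I x).
Proof.
move=> bad_x.
(* The empty set is admitted so that the union of the empty chain qualifies. *)
pose P (X : set A) := X = set0 \/ two_sided_ideal X /\ ~ two_units_mod X x.
have [F FP totF|X [PX max_X]] := @Zorn_bigcup A P.
  have [[X1 FX1 [t X1t]]|F0] := pselect (exists2 X, F X & exists t, X t); last first.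
    left; apply/seteqP; split=> // t [X FX Xt]; case: F0.
    by exists X => //; exists t.
  have ideal_F X a : F X -> X a -> two_sided_ideal X /\ ~ two_units_mod X x.
    by move=> FX Xa; have [X0|//] := FP X FX; move: Xa; rewrite X0.
  have inF s : (forall a, a \in s -> (\bigcup_(X in F) X)%classic a) ->
      exists2 X, F X & forall a, a \in t :: s -> X a.
    move=> sF; apply: (chain_contains totF FX1) => a /predU1P[->|/sF //].
    by exists X1.
  right; split; last first.
    case=> u [u' [v [v' [[uu' u'u] [vv' v'v] def_x]]]].
    have [a|X FX inX] := inF [:: u*u'-1; u'*u-1; v*v'-1; v'*v-1; x-(u+v)].
      by rewrite !inE => /or4P[/eqP->|/eqP->|/eqP->|/orP[]/eqP->].
    have [_] := ideal_F X t FX (inX t (mem_head _ _)); apply.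
    exists u, u', v, v'; split; first split; last 1 first.
    + by apply: inX; rewrite !inE eqxx !orbT.
    + by apply: inX; rewrite !inE eqxx !orbT.
    + by apply: inX; rewrite !inE eqxx !orbT.
    + by split; apply: inX; rewrite !inE eqxx !orbT.
  split; first split.
  - by exists X1 => //; have [[[]]] := ideal_F X1 t FX1 X1t.
  - move=> a b Fa Fb; have [c|X FX inX] := inF [:: a; b].
      by rewrite !inE => /orP[]/eqP->.
    have [[[_ XD _] _] _] := ideal_F X t FX (inX t (mem_head _ _)).
    by exists X => //; apply: XD; apply: inX; rewrite !inE eqxx ?orbT.
  - move=> c a [X FX Xa]; have [[[_ _ XM] _] _] := ideal_F X a FX Xa.
    by exists X => //; apply: XM.
  - move=> a c [X FX Xa]; have [[_ XMr] _] := ideal_F X a FX Xa.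
    by exists X => //; apply: XMr.
have {PX}[idX bad_X] : two_sided_ideal X /\ ~ two_units_mod X x.
  case: PX => // X0; case: (max_X (fun a => a = 0)).
    by rewrite X0; split=> // /(_ 0 erefl).
  by right; split; [exact: two_sided_ideal_zero | move/two_units_mod_zero].
exists (ideal_of idX); split; first by move/sum_of_two_units_factor.
move=> K a idK Ka nz_a; apply: two_units_mod_preim; apply: contrapT => bad_K.
have [K0 _ _] := idK.1.
apply: (max_X (K \o factor_proj (ideal_of idX))).
  split=> [b /in_ideal_of/factor_proj_eq0 /= -> //|sub].
  have [b def_a] := factor_proj_surj a; apply: nz_a; rewrite def_a.
  by apply/factor_proj_eq0/in_ideal_of/sub; rewrite /= -def_a.
by right; split=> //; apply: two_sided_ideal_preim.
Qed.

End FactorRings.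

(** * Rings spanned over a centralizing image *)

Section SpanningExtension.

Variables (R A : pzRingType) (iota : {rmorphism R -> A}) (n : nat) (h : 'I_n -> A).
Hypothesis h_comm : forall r i, iota r * h i = h i * iota r.
Hypothesis h_span : forall a, exists r : 'I_n -> R, a = \sum_i iota (r i) * h i.
Implicit Types (a b : A) (r s m : R).

(** A is spanned over the image of R by elements that centralize this image. *)
Lemma iota_central r :
  (forall s, GRing.comm (iota r) (iota s)) -> forall a, GRing.comm (iota r) a.
Proof.
move=> r_comm a; have [c ->] := h_span a; rewrite /GRing.comm mulr_sumr mulr_suml.
by apply: eq_bigr => i _; rewrite mulrA r_comm -!mulrA h_comm.
Qed.

Section Local.

Hypothesis A_nontrivial : 1 <> 0 :> A.
Hypothesis iota_local : forall r, (exists s, iota r * iota s = 1) \/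
  (exists s, iota (1 - r) * iota s = 1).

(** An idempotent of a local ring is 0 or 1; apply this to the image of s r,
    which is idempotent as soon as r s is mapped to 1. *)
Lemma iota_inverse_comm r s : iota r * iota s = 1 -> iota s * iota r = 1.
Proof.
move=> rs1; set p := iota s * iota r.
have pp : p * p = p by rewrite /p mulrA -(mulrA (iota s)) rs1 mulr1.
have := iota_local (s * r); rewrite rmorphB rmorph1 rmorphM -/p.
case=> -[t pt]; first by rewrite -pt {1}pt -[p in LHS]mulr1 -pt mulrA pp.
have p0 : p = 0.
  by rewrite -[p]mulr1 -pt mulrA mulrBr mulr1 pp subrr mul0r.
case: A_nontrivial; rewrite -[LHS]mulr1 -{1}rs1 -rs1 mulrA -(mulrA (iota r)) -/p.
by rewrite p0 mulr0 mul0r.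
Qed.

Definition nonunit r := ~ exists s, iota r * iota s = 1.

Lemma nonunit0 : nonunit 0.
Proof. by case=> s; rewrite rmorph0 mul0r => /esym. Qed.

Lemma nonunit_mulr m r : nonunit m -> nonunit (m * r).
Proof.
by move=> nu [s]; rewrite rmorphM -mulrA -rmorphM => ?; apply: nu; exists (r * s).
Qed.

Lemma nonunit_mull m r : nonunit m -> nonunit (r * m).
Proof.
move=> nu [s /iota_inverse_comm]; rewrite rmorphM mulrA -rmorphM => sr_m.
by apply: nu; exists (s * r); apply: iota_inverse_comm.
Qed.

Lemma nonunit_1B m : nonunit m -> exists s, iota s * iota (1 - m) = 1.
Proof.
move=> nu; have [//|[s ms]] := iota_local m.
by exists s; apply: iota_inverse_comm.
Qed.

Lemma nonunitD m r : nonunit m -> nonunit r -> nonunit (m + r).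
Proof.
move=> nu_m nu_r [s]; rewrite rmorphD mulrDl => def1.
have [t] := nonunit_1B (nonunit_mulr (r := s) nu_m).
rewrite rmorphB rmorph1 rmorphM -{1}def1 [iota m * _ + _]addrC addrK -rmorphM.
by move/iota_inverse_comm; rewrite rmorphM -mulrA -rmorphM => rst; apply: nu_r; exists (s * t).
Qed.

(** The ideal of A generated by the maximal ideal of the local ring iota(R). *)
Definition nonunit_comb a := exists2 m : 'I_n -> R,
  (forall i, nonunit (m i)) & a = \sum_i iota (m i) * h i.

Lemma nonunit_comb_iota m a : nonunit m -> nonunit_comb (iota m * a).
Proof.
move=> nu; have [r ->] := h_span a; exists (fun i => m * r i).
  by move=> i; apply: nonunit_mulr.
by rewrite mulr_sumr; apply: eq_bigr => i _; rewrite rmorphM mulrA.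
Qed.

Lemma nonunit_comb_ideal : two_sided_ideal nonunit_comb.
Proof.
have comb0 : nonunit_comb 0.
  exists (fun=> 0); first by move=> _; exact: nonunit0.
  by rewrite big1 // => i _; rewrite rmorph0 mul0r.
have combD a b : nonunit_comb a -> nonunit_comb b -> nonunit_comb (a + b).
  move=> [m nu_m ->] [r nu_r ->]; exists (fun i => m i + r i).
    by move=> i; apply: nonunitD.
  by rewrite -big_split; apply: eq_bigr => i _; rewrite rmorphD mulrDl.
split; first split=> // c _ [m nu ->]; last first.
  move=> _ c [m nu ->]; rewrite mulr_suml; apply: big_ind => // i _.
  by rewrite -mulrA; apply: nonunit_comb_iota.
rewrite mulr_sumr; apply: big_ind => // i _.
have [r ->] := h_span c; rewrite mulr_suml; apply: big_ind => // j _.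
rewrite -mulrA (mulrA (h j)) -h_comm -mulrA mulrA -rmorphM.
by apply/nonunit_comb_iota/nonunit_mull.
Qed.

(** Nakayama's lemma for the left ideal A(1 + z): modulo it every a is congruent
    to - a z, a combination of the h_i with nonunit coefficients. So the
    generators can be eliminated one at a time, the last one having in its own
    expression a coefficient m with 1 - m invertible. *)
Lemma nonunit_comb_quasiregular z : nonunit_comb z -> exists y, y * (1 + z) = 1.
Proof.
have [[comb0 combD combM] combMr] := nonunit_comb_ideal.
move=> comb_z.
(* Elements of A(1 + z) plus the span of the first k generators. *)
pose span_below k a := exists (y : A) (r : 'I_n -> R),
  a = y * (1 + z) + \sum_(i < n | (i < k)%N) iota (r i) * h i.
have span_belowD k a b : span_below k a -> span_below k b -> span_below k (a + b).
  move=> [y [r ->]] [y' [r' ->]]; exists (y + y'), (fun i => r i + r' i).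
  rewrite mulrDl addrACA -big_split; congr (_ + _).
  by apply: eq_bigr => i _; rewrite rmorphD mulrDl.
have span_belowM k r a : span_below k a -> span_below k (iota r * a).
  move=> [y [s ->]]; exists (iota r * y), (fun i => r * s i).
  rewrite mulrDr mulrA mulr_sumr; congr (_ + _).
  by apply: eq_bigr => i _; rewrite rmorphM mulrA.
suff span_all k : (k <= n)%N -> forall a, span_below (n - k)%N a.
  have [y [r]] := span_all n (leqnn n) 1.
  by rewrite subnn big_pred0 // addr0 => y1; exists y.
elim: k => [_ a|k IHk lt_kn].
  rewrite subn0; have [r ->] := h_span a; exists 0, r.
  by rewrite mul0r add0r; apply: eq_bigl => i; rewrite ltn_ord.
have {}IHk := IHk (ltnW lt_kn).
have lt_n : (n - k.+1 < n)%N by rewrite ltn_subrL (leq_trans _ lt_kn).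
move: IHk; rewrite -(subnSK lt_kn); move: (n - k.+1)%N lt_n => {lt_kn}k lt_kn IHk.
pose o := Ordinal lt_kn.
have sum_below (F : 'I_n -> A) :
    \sum_(i < n | (i < k.+1)%N) F i = F o + \sum_(i < n | (i < k)%N) F i.
  rewrite (bigD1 o) //=; congr (_ + _); apply: eq_bigl => i.
  by rewrite ltnS (ltn_neqAle i k) andbC.
pose nonunit_below (b : A) := exists (y : A) (m : 'I_n -> R),
  (forall i, nonunit (m i)) /\
  b = y * (1 + z) + \sum_(i < n | (i < k.+1)%N) iota (m i) * h i.
have nonunit_span_below b : nonunit_comb b -> nonunit_below b.
  case=> m nu ->; elim/big_ind: _ => [|_ _ [y [r [nu_r ->]]] [y' [r' [nu_r' ->]]]|i _].
  - exists 0, (fun=> 0); split; first by move=> _; apply: nonunit0.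
    by rewrite mul0r add0r big1 // => i _; rewrite rmorph0 mul0r.
  - exists (y + y'), (fun i => r i + r' i); split; first by move=> i; apply: nonunitD.
    rewrite mulrDl addrACA -big_split; congr (_ + _).
    by apply: eq_bigr => i _; rewrite rmorphD mulrDl.
  - have [y [r ->]] := IHk (h i); exists (iota (m i) * y), (fun j => m i * r j).
    split; first by move=> j; apply: nonunit_mulr.
    rewrite mulrDr mulrA mulr_sumr; congr (_ + _).
    by apply: eq_bigr => j _; rewrite rmorphM mulrA.
have span_o : span_below k (h o).
  have [|y [m [nu def_b]]] := nonunit_span_below (- (h o * z)).
    by rewrite -mulrN; apply/combM/(left_idealN nonunit_comb_ideal.1).
  have [s sm] := nonunit_1B (nu o).
  rewrite -[h o]mul1r -sm -mulrA; apply: span_belowM.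
  exists (h o + y), m; rewrite rmorphB rmorph1 mulrBl mul1r mulrDl.
  apply/eqP; rewrite subr_eq -!addrA [X in y * _ + X]addrC -sum_below -def_b.
  by rewrite mulrDr mulr1 addrK.
move=> a; have [y [r ->]] := IHk a; rewrite sum_below.
rewrite addrCA; apply: span_belowD; first exact: span_belowM.
by exists y, r.
Qed.

End Local.

Section Division.

Hypothesis iota_division : forall r, iota r = 0 \/ exists s, iota s * iota r = 1.

(** The length of a left ideal L counts the pivots in an echelon form of the
    space of coordinate vectors representing elements of L; relations between
    the h_i do no harm, since 0 is in L. *)
Lemma exists_left_length : exists len, left_length (A := A) len.
Proof.
pose comb (r : 'I_n -> R) := \sum_i iota (r i) * h i.
pose lead (L : A -> Prop) (i : 'I_n) := exists r : 'I_n -> R,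
  [/\ iota (r i) = 1, forall j : 'I_n, (j < i)%N -> iota (r j) = 0 & L (comb r)].
exists (fun L => #|[set i | `[< lead L i >]]|) => L N idL idN LN le_len.
have [[L0 LD LM] [N0 ND NM]] := (idL, idN).
have lead_eq i : lead N i -> lead L i.
  move=> Ni; have/eqP/setP/(_ i) : [set i | `[< lead L i >]] == [set i | `[< lead N i >]].
    rewrite eqEcard le_len andbT; apply/fintype.subsetP => j; rewrite !inE.
    by move=> [r [r1 r0 Lr]]; exists r; split=> //; apply: LN.
  by rewrite !inE => eqi; apply/asboolP; rewrite eqi; apply/asboolP.
suff step k (r : 'I_n -> R) : (k <= n)%N ->
    (forall j : 'I_n, (j < n - k)%N -> iota (r j) = 0) -> N (comb r) -> L (comb r).
  move=> a; have [r ->] := h_span a; apply: (step n r) => // j.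
  by rewrite subnn.
elim: k r => [|k IHk] r.
  move=> _ r0 _; rewrite /comb big1 // => i _.
  by rewrite r0 ?subn0 ?mul0r.
move=> lt_kn; have {}IHk := IHk ^~ (ltnW lt_kn).
have lt_n : (n - k.+1 < n)%N by rewrite ltn_subrL (leq_trans _ lt_kn).
move: IHk; rewrite -(subnSK lt_kn); move: (n - k.+1)%N lt_n => {lt_kn}k lt_kn IHk.
pose o := Ordinal lt_kn => r0 Nr.
have [ro0|[s sr]] := iota_division (r o).
  apply: IHk => // j; rewrite ltnS leq_eqVlt => /predU1P[jk|/r0//].
  by rewrite (_ : j = o) //; apply: val_inj.
have [|t [t1 t0 Lt]] := lead_eq o.
  exists (fun i => s * r i); split; first by rewrite rmorphM.
    by move=> j /r0 rj0; rewrite rmorphM rj0 mulr0.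
  rewrite (_ : comb _ = iota s * comb r); first exact: NM.
  by rewrite /comb mulr_sumr; apply: eq_bigr => i _; rewrite rmorphM mulrA.
have comb_sub : comb (fun i => r i - r o * t i) = comb r - iota (r o) * comb t.
  rewrite /comb mulr_sumr -sumrB; apply: eq_bigr => i _.
  by rewrite rmorphB rmorphM mulrBl mulrA.
rewrite -(subrK (iota (r o) * comb t) (comb r)) -comb_sub.
apply: LD; last exact: LM.
apply: IHk => [j|]; last by rewrite comb_sub; apply: left_idealB => //; apply/NM/LN.
rewrite ltnS leq_eqVlt rmorphB rmorphM => /predU1P[jk|lt_jk].
  by rewrite (_ : j = o) ?t1 ?mulr1 ?subrr //; apply: val_inj.
by rewrite r0 // t0 // mulr0 subrr.
Qed.

End Division.

End SpanningExtension.

(** * No maximal counterexample exists *)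

(** Wedderburn's little theorem, for a ring without a chosen finite type or unit
    structure. *)
Lemma finite_division_ring_commutative (D : pzRingType) (s : seq D) :
  (forall d, d \in s) -> 1 <> 0 :> D -> (forall d : D, d <> 0 -> is_unit d) ->
  forall c d : D, c * d = d * c.
Proof.
move=> s_all nz1 units.
have /choice[inv invP] (d : D) : exists d', if d == 0 then d' = d
    else d' * d = 1 /\ d * d' = 1.
  case: eqP => [_|/units[d' [dd' d'd]]]; first by exists d.
  by exists d'.
have pickleK : pcancel (index^~ s) (fun i => Some (nth 0 s i)).
  by move=> d; rewrite nth_index.
have finD : Finite.axiom (undup s).
  by move=> d; rewrite count_uniq_mem ?undup_uniq // mem_undup s_all.
have invV : {in fun d : D => d != 0, left_inverse 1 inv *%R}.
  by move=> d nz_d; have := invP d; rewrite (negPf (nz_d : d != 0)); case.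
have Vinv : {in fun d : D => d != 0, right_inverse 1 inv *%R}.
  by move=> d nz_d; have := invP d; rewrite (negPf (nz_d : d != 0)); case.
have unitP (c d : D) : d * c = 1 /\ c * d = 1 -> c != 0.
  by case=> dc _; apply/eqP => c0; apply: nz1; rewrite -dc c0 mulr0.
have inv_out : {in [predC fun d : D => d != 0], inv =1 id}.
  by move=> d d0; have := invP d; rewrite (negbNE (d0 : ~~ (d != 0))).
have nz1b : 1 != 0 :> D by apply/eqP.
pose N : nzRingType := HB.pack D (GRing.PzSemiRing_isNonZero.Build D nz1b).
pose U : finUnitRingType := HB.pack N
  (isCountable.Build D pickleK) (isFinite.Build D finD)
  (GRing.NzRing_hasMulInverse.Build N invV Vinv unitP inv_out).
apply: (@finDomain_mulrC U) => c d cd0; apply/norP => -[nz_c /eqP].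
by apply; rewrite -[d]mul1r -(invV c nz_c) -mulrA [c * d]cd0 mulr0.
Qed.

Lemma two_element_ring_F2 (D : pzRingType) :
  1 <> 0 :> D -> (forall d : D, d = 0 \/ d = 1) -> ring_isomorphic D 'F_2.
Proof.
move=> nz1 D01; pose f (d : D) : 'F_2 := (d != 0)%:R.
have f1 : f 1 = 1 by rewrite /f (introF eqP nz1).
have f0 : f 0 = 0 by rewrite /f eqxx.
have opp1 : - 1 = 1 :> D.
  have [/eqP|//] := D01 (- 1); rewrite oppr_eq0 => /eqP; exact: contraPeq.
have fB : zmod_morphism f.
  move=> a b; case: (D01 a) => ->; case: (D01 b) => ->;
    rewrite ?subr0 ?subrr ?sub0r ?opp1 ?f0 ?f1 ?subr0 ?subrr //.
  by apply/eqP.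
have fM : monoid_morphism f.
  split=> // a b; case: (D01 a) => ->; case: (D01 b) => ->;
  by rewrite ?mul0r ?mulr0 ?mulr1 ?f0 ?f1 ?mul0r ?mulr0 ?mulr1.
pose F : {rmorphism D -> 'F_2} := HB.pack f
  (GRing.isZmodMorphism.Build D 'F_2 f fB)
  (GRing.isMonoidMorphism.Build D 'F_2 f fM).
exists F; exists (fun y : 'F_2 => if y == 0 then 0 else 1 : D).
  by move=> d; case: (D01 d) => ->; rewrite /= ?f0 ?f1.
case=> [[|[|//]] lt_y2]; rewrite /= ?f0 ?f1; exact: val_inj.
Qed.

(** Write 1 as the sum of the p_i.1 e p_i.2 on both sides of a: the element a is
    then determined by which of the corners e (p_i.2 a p_j.1) e equal e. *)
Lemma finite_of_trivial_corner (A : pzRingType) (e : A) :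
  ideal_generated e 1 -> (forall b, e * b * e = 0 \/ e * b * e = e) ->
  exists s : seq A, forall a, a \in s.
Proof.
case=> s def1 corner; set k := size s.
pose p (i : 'I_k) := tnth (in_tuple s) i.
pose F (m : {ffun 'I_k * 'I_k -> bool}) : A :=
  \sum_i \sum_j (p i).1 * (if m (i, j) then e else 0) * (p j).2.
exists (codom F) => a.
pose m := [ffun ij : 'I_k * 'I_k => e * ((p ij.1).2 * a * (p ij.2).1) * e == e].
suff -> : a = F m by apply: codom_f.
rewrite -[LHS]mulr1 -[a in LHS]mul1r def1 !(big_tnth _ _ s) !mulr_suml.
apply: eq_bigr => i _; rewrite mulr_sumr; apply: eq_bigr => j _.
rewrite -/(p i) -/(p j) ffunE /=.
have -> : (p i).1 * e * (p i).2 * a * ((p j).1 * e * (p j).2) =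
    (p i).1 * (e * ((p i).2 * a * (p j).1) * e) * (p j).2 by rewrite !mulrA.
case: eqP => [->//|ne]; congr (_ * _ * _).
by case: (corner ((p i).2 * a * (p j).1)) => // /ne.
Qed.

Section SumOfTwoUnits.

Variables (R A : pzRingType) (iota : {rmorphism R -> A}) (n : nat) (h : 'I_n -> A).
Hypothesis h_comm : forall r i, iota r * h i = h i * iota r.
Hypothesis h_span : forall a, exists r : 'I_n -> R, a = \sum_i iota (r i) * h i.
Hypothesis R_abelian : abelian_ring R.
Hypothesis R_exchange : exchange_ring R.
Hypothesis R_noF2 :
  ~ (exists I : twoSidedIdeal R, ring_isomorphic (factor_ring I) 'F_2).

(** At a critical element the image of R is a division ring and A is simple of
    finite length, so only a corner eAe = {0, e} could prevent x from being a
    sum of two units; such a corner makes iota(R) a copy of F_2. *)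
Lemma not_critical x : ~ critical (x : A).
Proof.
move=> crit_x; have nz1 := critical_nontrivial crit_x.
have iota_local r : (exists s, iota r * iota s = 1) \/
    (exists s, iota (1 - r) * iota s = 1).
  have [e [ee [s es] [t et]]] := R_exchange r.
  have e_central a : GRing.comm (iota e) a.
    apply: (iota_central h_comm h_span) => r'.
    by rewrite /GRing.comm -!rmorphM R_abelian.
  have [|e0|e1] := critical_central_idempotent crit_x _ e_central.
  - by rewrite /is_idempotent -rmorphM ee.
  - by right; exists t; rewrite -rmorphM -et rmorphB rmorph1 e0 subr0.
  - by left; exists s; rewrite -rmorphM -es.
have iota_comm := iota_inverse_comm nz1 iota_local.
have nonunit_quasi := nonunit_comb_quasiregular h_comm h_span nz1 iota_local.
have id_nonunit := nonunit_comb_ideal h_comm h_span nz1 iota_local.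
have iota_division r : iota r = 0 \/ exists s, iota s * iota r = 1.
  have [[s rs]|nu] := pselect (exists s, iota r * iota s = 1).
    by right; exists s; apply: iota_comm.
  left; rewrite -[iota r]mulr1; apply: (critical_quasiregular_ideal crit_x id_nonunit).
    exact: nonunit_quasi.
  exact: nonunit_comb_iota.
have [len len_mono] := exists_left_length h_span iota_division.
have semiprimeA := critical_semiprime crit_x.
have simpleA := critical_simple crit_x len_mono.
have [bad _] := crit_x; apply: bad.
apply: (sum_of_two_units_simple len_mono semiprimeA simpleA).
move=> e [ee nz_e min_e]; apply: contrapT => no_d.
have corner b : e * b * e = 0 \/ e * b * e = e.
  apply: contrapT => /not_orP[nz_d d_e]; apply: no_d; exists (e * b * e).
  by rewrite -!mulrA ee !mulrA ee.
have [s s_all] := finite_of_trivial_corner (simpleA e nz_e) corner.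
pose ker r := iota r = 0.
have id_ker : two_sided_ideal ker.
  split; first split; rewrite /ker ?rmorph0 //.
  - by move=> a b a0 b0; rewrite rmorphD a0 b0 addr0.
  - by move=> a b b0; rewrite rmorphM b0 mulr0.
  - by move=> a b a0; rewrite rmorphM a0 mul0r.
pose pr := factor_proj (ideal_of id_ker).
have pr0 : pr 0 = 0 by exact: rmorph0.
have pr1 : pr 1 = 1 by exact: rmorph1.
have prM r t : pr (r * t) = pr r * pr t by exact: rmorphM.
have pr_eq r t : pr r = pr t <-> iota r = iota t.
  split=> [/factor_proj_eq/in_ideal_of|rt].
    by rewrite /ker rmorphB => /eqP; rewrite subr_eq0 => /eqP.
  by apply/factor_proj_eq/in_ideal_of; rewrite /ker rmorphB rt subrr.
have nz_pr1 : 1 <> 0 :> factor_ring (ideal_of id_ker).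
  by rewrite -pr1 -pr0 => /pr_eq; rewrite rmorph1 rmorph0.
(* Wedderburn's theorem is applied to R / ker iota, a copy of iota(R). *)
have iotaC r t : iota r * iota t = iota t * iota r.
  have /choice[lift liftP] a : exists r, (exists r', iota r' = a) -> iota r = a.
    have [[r' def_a]|no] := pselect (exists r, iota r = a).
      by exists r'.
    by exists 0 => /no.
  rewrite -!rmorphM; apply/pr_eq; rewrite !prM.
  apply: (@finite_division_ring_commutative _ [seq pr (lift a) | a <- s]) => //.
    move=> d; have [r' ->] := factor_proj_surj d; apply/mapP; exists (iota r') => //.
    by apply/esym/pr_eq; apply: liftP; exists r'.
  move=> d nz_d; have [r' def_d] := factor_proj_surj d.
  have [r'0|[t' t'r']] := iota_division r'.
    by case: nz_d; rewrite def_d -pr0; apply/pr_eq; rewrite r'0 rmorph0.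
  exists (pr t'); rewrite def_d -!prM -pr1.
  by split; apply/pr_eq; rewrite rmorphM rmorph1 // iota_comm.
(* Now iota(r) is central, so iota(r) e lies in eAe = {0, e}. *)
have iota01 r : iota r = 0 \/ iota r = 1.
  have r_central : GRing.comm (iota r) e by apply: (iota_central h_comm h_span).
  have ere : e * iota r * e = iota r * e by rewrite -r_central -mulrA ee.
  have div0 t : iota t * e = 0 -> iota t = 0.
    move=> te0; have [//|[t' t't]] := iota_division t.
    by case: nz_e; rewrite -[e]mul1r -t't -mulrA te0 mulr0.
  have := corner (iota r); rewrite ere => -[/div0|re]; [by left | right].
  have r1 : iota (r - 1) = 0.
    by apply: div0; rewrite rmorphB rmorph1 mulrBl re mul1r subrr.
  by apply/eqP; rewrite -subr_eq0 -(rmorph1 iota) -rmorphB r1.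
apply: R_noF2; exists (ideal_of id_ker); apply: two_element_ring_F2 => // d.
have [r ->] := factor_proj_surj d.
by have [r0|r1] := iota01 r; [left; rewrite -pr0 | right; rewrite -pr1];
   apply/pr_eq; rewrite ?rmorph0 ?rmorph1.
Qed.

End SumOfTwoUnits.

(** A maximal bad quotient of A inherits the spanning family, which contradicts
    [not_critical]. *)
Theorem sum_of_two_units_spanned (R A : pzRingType) (iota : {rmorphism R -> A})
  (n : nat) (h : 'I_n -> A) :
  (forall r i, iota r * h i = h i * iota r) ->
  (forall a, exists r : 'I_n -> R, a = \sum_i iota (r i) * h i) ->
  abelian_ring R -> exchange_ring R ->
  ~ (exists I : twoSidedIdeal R, ring_isomorphic (factor_ring I) 'F_2) ->
  forall x : A, sum_of_two_units x.
Proof.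
move=> h_comm h_span R_abelian R_exchange noF2 x; apply: contrapT => bad.
have [I] := exists_critical_factor bad; pose p := factor_proj I.
apply: (@not_critical R _ (p \o iota) n (p \o h)) => // [r i | y] /=.
  by rewrite -!rmorphM h_comm.
have [a ->] := factor_proj_surj y; have [r ->] := h_span a; exists r.
by rewrite rmorph_sum; apply: eq_bigr => i _; rewrite rmorphM.
Qed.

(** * The group ring *)

Lemma sum_of_two_units_rmorph (R S : pzRingType) (f : {rmorphism R -> S}) x :
  sum_of_two_units x -> sum_of_two_units (f x).
Proof.
have f_unit u : is_unit u -> is_unit (f u).
  by case=> v [uv vu]; exists (f v); rewrite -!rmorphM uv vu rmorph1.
case=> u [v [Uu Uv ->]]; exists (f u), (f v).
by rewrite rmorphD; split=> //; apply: f_unit.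
Qed.

Lemma F2_one_not_sum_of_two_units : ~ sum_of_two_units (1 : 'F_2).
Proof.
have unit1 (u : 'F_2) : is_unit u -> u = 1.
  case=> v [uv _]; case: u uv => -[|[|//]] lt_u2 uv; last exact: val_inj.
  by move/eqP: uv; rewrite (_ : Ordinal _ = 0) ?mul0r //; apply: val_inj.
by case=> u [v [/unit1-> /unit1-> /eqP]].
Qed.

Section Augmentation.

Variables (R : pzRingType) (G : groupType).
Local Open Scope fset_scope.

Definition augmentation (g : group_ring R G) : R := \sum_(k <- msupp g) g@_k.

Lemma augmentation_incl (d : {fset G}) (g : group_ring R G) :
  msupp g `<=` d -> augmentation g = \sum_(k <- d) g@_k.
Proof.
by move=> le_gd; apply: big_fset_incl => // k _ /mcoeff_outdom.
Qed.

Lemma augmentationU c k : augmentation << c *g k >> = c.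
Proof. by rewrite (augmentation_incl msuppU_le) big_seq_fset1 mcoeffUU. Qed.

Lemma augmentation_is_zmod_morphism : zmod_morphism augmentation.
Proof.
move=> f g; pose d := msupp f `|` msupp g.
rewrite (augmentation_incl (msuppB_le f g)).
rewrite (augmentation_incl (fsubsetUl (msupp f) (msupp g))).
rewrite (augmentation_incl (fsubsetUr (msupp f) (msupp g))).
by rewrite -sumrB; apply: eq_bigr => k _; rewrite mcoeffB.
Qed.

HB.instance Definition _ :=
  GRing.isZmodMorphism.Build (group_ring R G) R augmentation
    augmentation_is_zmod_morphism.

Lemma augmentation_is_monoid_morphism : monoid_morphism augmentation.
Proof.
split=> [|f g]; first exact: augmentationU.
rewrite -[f * g]/(group_ring_mul f g) raddf_sum [in RHS]/augmentation mulr_suml.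
apply: eq_bigr => k _; rewrite raddf_sum mulr_sumr.
by apply: eq_bigr => l _; rewrite /= augmentationU.
Qed.

HB.instance Definition _ :=
  GRing.isMonoidMorphism.Build (group_ring R G) R augmentation
    augmentation_is_monoid_morphism.

End Augmentation.

Section SupportedRing.

Variables (R : pzRingType) (G : groupType) (H : set G).
Hypothesis subH : is_subgroup H.
Local Open Scope fset_scope.

(** The subring RH of RG, for a subgroup H; the proof that H is a subgroup is an
    argument so that the ring structure can be inferred from the type. *)
Definition supported_on (_ : is_subgroup H) : group_ring R G -> bool :=
  fun g => `[< forall k, k \in msupp g -> H k >].

Local Notation S := (supported_on subH).

Lemma supported_onP g : reflect (forall k, k \in msupp g -> H k) (g \in S).
Proof. exact: asboolP. Qed.

Lemma supported_onU c k : H k -> (<< c *g k >> : group_ring R G) \in S.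
Proof.
move=> Hk; apply/supported_onP => l.
by move/(fsubsetP msuppU_le); rewrite in_fset1 => /eqP->.
Qed.

Lemma supported_on_zmod_closed : zmod_closed S.
Proof.
split; first by apply/supported_onP => k; rewrite msupp0.
move=> f g /supported_onP Sf /supported_onP Sg; apply/supported_onP => k.
by move/(fsubsetP (msuppB_le f g)); rewrite in_fsetU => /orP[/Sf|/Sg].
Qed.

HB.instance Definition _ :=
  GRing.isZmodClosed.Build (group_ring R G) S supported_on_zmod_closed.

Lemma supported_on_subring_closed : subring_closed S.
Proof.
have [H1 HM _] := subH.
split=> [|f g Sf Sg|f g Sf Sg]; first exact: supported_onU.
  exact: rpredB.
rewrite -[f * g]/(group_ring_mul f g) /group_ring_mul.
rewrite big_seq; apply: rpred_sum => k /(supported_onP _ Sf) Hk.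
rewrite big_seq; apply: rpred_sum => l /(supported_onP _ Sg) Hl.
by apply: supported_onU; apply: HM.
Qed.

Record supported_ring := SupportedElement {
  supported_val : group_ring R G;
  _ : supported_val \in S
}.

HB.instance Definition _ := [isSub for supported_val].
HB.instance Definition _ := [Choice of supported_ring by <:].
HB.instance Definition _ :=
  GRing.SubChoice_isSubPzRing.Build (group_ring R G) S supported_ring
    supported_on_subring_closed.

Definition supported_elt g (Sg : g \in S) : supported_ring := Sub g Sg.

Lemma one_in_H : H 1%g. Proof. by case: subH. Qed.

Definition scalar (r : R) : supported_ring :=
  supported_elt (supported_onU r one_in_H).

Lemma scalar_is_zmod_morphism : zmod_morphism scalar.
Proof. by move=> r s; apply: val_inj; rewrite rmorphB; exact: monalgUB. Qed.

Lemma scalar_is_monoid_morphism : monoid_morphism scalar.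
Proof.
split=> [|r s]; first exact/val_inj.
apply: val_inj; rewrite rmorphM -[RHS]/(group_ring_mul << r *g 1%g >> << s *g 1%g >>).
by rewrite group_ring_mulUU mulg1.
Qed.

HB.instance Definition _ :=
  GRing.isZmodMorphism.Build R supported_ring scalar scalar_is_zmod_morphism.
HB.instance Definition _ :=
  GRing.isMonoidMorphism.Build R supported_ring scalar scalar_is_monoid_morphism.

Lemma supported_ring_spanned : finite_set H ->
  exists n (h : 'I_n -> supported_ring),
    (forall r i, scalar r * h i = h i * scalar r) /\
    forall a, exists r : 'I_n -> R, a = \sum_i scalar (r i) * h i.
Proof.
case/finite_fsetP => d def_H.
have Hd (i : 'I_(size d)) : H (tnth (in_tuple d) i).
  by rewrite def_H /=; exact: mem_tnth.
exists (size d), (fun i => supported_elt (supported_onU 1 (Hd i))); split.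
  move=> r i; apply: val_inj; rewrite !rmorphM.
  rewrite -[LHS]/(group_ring_mul _ _) -[RHS]/(group_ring_mul _ _).
  by rewrite !group_ring_mulUU mulr1 mul1r mulg1 mul1g.
move=> a; exists (fun i => (val a)@_(tnth (in_tuple d) i)); apply: val_inj.
have le_ad : msupp (val a) `<=` d.
  apply/fsubsetP => k; have /supported_onP Sa := valP a.
  by move/Sa; rewrite def_H.
rewrite [LHS](monalgEw le_ad) big_tnth rmorph_sum; apply: eq_bigr => i _.
rewrite rmorphM -[RHS]/(group_ring_mul _ _) group_ring_mulUU.
by rewrite mulr1 mul1g.
Qed.

End SupportedRing.

Lemma generated_subgroup_is_subgroup (G : groupType) (X : set G) :
  is_subgroup (generated_subgroup X).
Proof.
split=> [K [[]] //|x y Xx Xy K XK|x Xx K XK].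
  by have [[_ KM _] _] := XK; apply: KM; [apply: Xx | apply: Xy].
by have [[_ _ KV] _] := XK; apply: KV; apply: Xx.
Qed.


Theorem theorem8 (R : pzRingType) (G : groupType)
  (R_abelian : abelian_ring R) (R_exchange : exchange_ring R)
  (G_locally_finite : locally_finite G) :
  [<-> sum_of_two_units (1 : group_ring R G);
       sum_of_two_units (1 : R);
       ~ (exists I : twoSidedIdeal R, ring_isomorphic (factor_ring I) 'F_2);
       forall x : group_ring R G, sum_of_two_units x].
Proof.
tfae.
- by move/(sum_of_two_units_rmorph (@augmentation R G)); rewrite rmorph1.
- move=> R1 [I [f _]]; apply: F2_one_not_sum_of_two_units.
  by rewrite -(rmorph1 (f \o factor_proj I)); apply: sum_of_two_units_rmorph.
- move=> noF2 x; pose X : set G := [set` msupp x]%classic; pose H := generated_subgroup X.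
  have subH : is_subgroup H by apply: generated_subgroup_is_subgroup.
  have finH : finite_set H.
    by apply: G_locally_finite => //; exists X => //; exact: finite_fset.
  have [n [h [h_comm h_span]]] := supported_ring_spanned R subH finH.
  have Sx : x \in supported_on subH by apply/supported_onP => k xk K [_]; apply.
  have := sum_of_two_units_spanned h_comm h_span R_abelian R_exchange noF2
    (supported_elt Sx).
  by move/(sum_of_two_units_rmorph val).
- exact.
Qed.
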